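(* Let $M\neq\emptyset$, let $(M,\mathcal C)$ be a differential space such that $(M,\tau_{\mathcal C})$ is Hausdorff, and let $\mathcal G$ and $\mathcal H$ be families of generators of $\mathcal C$ all of whose elements are bounded functions. If $\mathcal G\subset\mathcal H$, then there exists a smooth map $$\iota_{\mathcal G\mathcal H}:(\mathrm{compt}_{\mathcal H}M,\mathrm{compt}_{\mathcal H}\mathcal C)\to(\mathrm{compt}_{\mathcal G}M,\mathrm{compt}_{\mathcal G}\mathcal C)$$ such that $\iota_{\mathcal G\mathcal H}|_M=\mathrm{id}_M$.
   Context: Differential spaces (Sikorski). For a nonempty set $M$ and a family $\mathcal C$ of functions $M\to\mathbb R$, $\tau_{\mathcal C}$ is the weakest topology on $M$ making all functions of $\mathcal C$ continuous. $\mathcal C$ is a differential structure on $M$ if: (a) every $f:M\to\mathbb R$ such that each $m\in M$ has a $\tau_{\mathcal C}$-neighbourhood $V$ and some $\alpha\in\mathcal C$ with $f|_V=\alpha|_V$ belongs to $\mathcal C$; and (b) $\omega\circ(\alpha_1,\dots,\alpha_n)\in\mathcal C$ for all $n\in\mathbb N$, $\omega\in C^\infty(\mathbb R^n)$, $\alpha_1,\dots,\alpha_n\in\mathcal C$. Then $(M,\mathcal C)$ is a differential space. For a family $\mathcal F$ of real functions on $M$, $\mathrm{gen}(\mathcal F)$ is the smallest differential structure on $M$ containing $\mathcal F$; if $\mathcal C=\mathrm{gen}(\mathcal F)$, then $\mathcal F$ is a family of generators of $\mathcal C$. A map $F:(M,\mathcal C)\to(N,\mathcal D)$ is smooth if $\beta\circ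 F\in\mathcal C$ for all $\beta\in\mathcal D$. Differential compactification. Let $(M,\tau_{\mathcal C})$ be Hausdorff and let $\mathcal G$ be a family of bounded generators of $\mathcal C$ (for instance with values in $[-1,1]$). The generator embedding $\phi_{\mathcal G}:M\to\mathbb R^{\mathcal G}$, $\phi_{\mathcal G}(m)=(g(m))_{g\in\mathcal G}$, is injective with image in a product of compact intervals. $\mathrm{compt}_{\mathcal G}M$ is the (compact) closure of $\phi_{\mathcal G}(M)$ in $\mathbb R^{\mathcal G}$ with the product topology, and $\mathrm{compt}_{\mathcal G}\mathcal C$ is the differential structure on it generated by the restrictions of the coordinate projections $pr_g:\mathbb R^{\mathcal G}\to\mathbb R$, $g\in\mathcal G$. $M$ is identified with the dense subset $\phi_{\mathcal G}(M)$ of $\mathrm{compt}_{\mathcal G}M$; thus $\iota_{\mathcal G\mathcal H}|_M=\mathrm{id}_M$ means $\iota_{\mathcal G\mathcal H}\circ\phi_{\mathcal H}=\phi_{\mathcal G}$. *)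

(* Defs.v *)
From HB Require Import structures.
From mathcomp Require Import all_boot all_order all_algebra.
From mathcomp Require Import all_classical all_reals all_analysis.
Import numFieldNormedType.Exports.
Set Implicit Arguments.
Unset Strict Implicit.
Unset Printing Implicit Defensive.
Import Order.TTheory GRing.Theory Num.Theory.
Local Open Scope classical_set_scope.
Local Open Scope ring_scope.

(* Functions R^n -> R all of whose partial derivatives of order at most [k]
   exist everywhere and are continuous. *)
Fixpoint class_C (R : realType) (n k : nat) (w : 'rV[R]_n -> R) : Prop :=
  if k is k'.+1 then
    [/\ continuous w,
        forall (i : 'I_n) x, derivable w x (delta_mx 0 i) &
        forall i : 'I_n, class_C k' (fun x => 'D_(delta_mx 0 i) w x)]
  else continuous w.

Definition C_infty (R : realType) (n : nat) (w : 'rV[R]_n -> R) : Prop :=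
  forall k, class_C k w.

(* The carrier [M] with the weakest topology making all functions of [C]
   continuous: the supremum of the initial topologies of the members of [C]. *)
Definition diff_topology (R : realType) (M : choiceType) (C : set (M -> R))
    : topologicalType :=
  sup_topology (fun a : C => Topological.on (initial_topology (set_val a))).

(* The arity [n] may be 0, so a differential structure contains the constant
   functions; in particular the empty family is not one. *)
Definition differential_structure (R : realType) (M : choiceType)
    (C : set (M -> R)) : Prop :=
  (forall f : M -> R,
     (forall m : M, exists V : set (diff_topology C), nbhs (m : diff_topology C) V /\
        exists2 a, C a & forall x, V x -> f x = a x) ->
     C f) /\
  (forall (n : nat) (w : 'rV[R]_n -> R) (a : 'I_n -> M -> R),
     C_infty w -> (forall i, C (a i)) -> C (fun m => w (\row_i a i m))).

(* [smallest] is the intersection of all differential structures containing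
   [F]; it is itself one by [gen_differential_structure] below. *)
Definition gen (R : realType) (M : choiceType) (F : set (M -> R))
    : set (M -> R) :=
  smallest (@differential_structure R M) F.

Definition smooth_map (R : realType) (M N : choiceType)
    (C : set (M -> R)) (D : set (N -> R)) (F : M -> N) : Prop :=
  forall b, D b -> C (b \o F).

Section compactification.
Variables (R : realType) (M : choiceType) (G : set (M -> R)).

Definition gen_embedding (m : M) : {ptws G -> R} := fun g => set_val g m.

Definition compt_set : set {ptws G -> R} := closure (range gen_embedding).

Definition compt : choiceType := set_type compt_set.

Definition compt_proj (g : G) (x : compt) : R := set_val x g.

Definition compt_structure : set (compt -> R) := gen (range compt_proj).

Lemma gen_embedding_compt m : gen_embedding m \in compt_set.
Proof. by apply/mem_set/subset_closure; exists m. Qed.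

Definition to_compt (m : M) : compt :=
  exist (fun x => x \in compt_set) (gen_embedding m) (gen_embedding_compt m).

End compactification.

Arguments compt_structure {R M} G.

Lemma diff_topology_nbhsS (R : realType) (M : choiceType) (C D : set (M -> R))
    (m : M) (V : set M) :
  C `<=` D -> nbhs (m : diff_topology C) V -> nbhs (m : diff_topology D) V.
Proof.
move=> CD; move: V.
have FD : Filter (nbhs (m : diff_topology D)) := nbhs_filter _.
apply/(@cvg_sup _ _ _ (nbhs (m : diff_topology D)) m FD) => -[a aC].
have aD : a \in D by apply/mem_set/CD/set_mem.
move/cvg_sup : (@cvg_id _ (nbhs (m : diff_topology D))).
by move=> /(_ (exist _ a aD)).
Qed.

Lemma gen_differential_structure (R : realType) (M : choiceType)
    (F : set (M -> R)) : differential_structure (gen F).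
Proof.
split=> [f floc C [CD FC]|n w a ws ag C [CD FC]]; last first.
  by apply: (proj2 CD) => // i; exact: ag.
apply: (proj1 CD) => m; have [V [mV [a ga fa]]] := floc m.
exists V; split; last by exists a => //; exact: ga.
by apply: diff_topology_nbhsS mV; exact: smallest_sub.
Qed.

(* Main.v *)
(** The map iota forgets the coordinates indexed by H \ G.  It is continuous for
    the product topologies, hence sends the closure of the image of M to the
    closure of the image of M.  Smoothness may be tested on generators, and the
    G-coordinates of iota are H-coordinates. *)
Require Import Defs.
From mathcomp Require Import all_boot all_order all_algebra.
From mathcomp Require Import all_classical all_reals all_analysis.
Import numFieldNormedType.Exports.
Local Open Scope classical_set_scope.
Local Open Scope ring_scope.

Section sup_initial.
Context {I : Type} {S : choiceType} {K : I -> topologicalType}.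
Variable p : forall i, S -> K i.

(** Both [diff_topology] and the product topology on [{ptws G -> R}] unfold to this supremum, so the
    two lemmas below serve for both. *)
Let T_p : topologicalType :=
  sup_topology (fun i => Topological.on (initial_topology (p i))).

Lemma sup_initial_proj_continuous i : continuous (p i : T_p -> K i).
Proof.
move=> x; apply: cvg_trans (@initial_continuous _ _ (p i) x).
apply: cvg_app.
by move/cvg_sup : (@cvg_id _ (nbhs (x : T_p))); apply.
Qed.

Lemma continuous_sup_initial (T : topologicalType) (f : T -> T_p) :
  (forall i, continuous (p i \o f)) -> continuous f.
Proof.
move=> pf x; apply/cvg_sup => i.
exact: (@continuous_comp_initial _ _ _ (p i) f (pf i)).
Qed.

End sup_initial.

(** Only the composites with members of [D] need be continuous; smoothness puts them in [C], whose
    members are continuous by the choice of topology. *)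
Lemma diff_topology_continuous {R : realType} {M N : choiceType}
    {C : set (M -> R)} {D : set (N -> R)} {F : M -> N} :
  smooth_map C D F -> continuous (F : diff_topology C -> diff_topology D).
Proof.
move=> CDF; apply: continuous_sup_initial => b.
have CbF : set_val b \o F \in C by apply/mem_set/CDF/set_valP.
exact: (@sup_initial_proj_continuous C M (fun=> R) set_val
  (exist _ (set_val b \o F) CbF)).
Qed.

(** The functions that [F] pulls back into [C] form a differential structure containing [B], hence
    contain the smallest one, [gen B]. *)
Lemma smooth_map_gen {R : realType} {M N : choiceType}
    {C : set (M -> R)} {B : set (N -> R)} {F : M -> N} :
  differential_structure C -> (forall b, B b -> C (b \o F)) ->
  smooth_map C (gen B) F.
Proof.
move=> Cdiff CBF b gb; pose D := [set c : N -> R | C (c \o F)].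
(* True by the choice of [D]; it makes [F] continuous for the topology of [D] itself, so the
   neighbourhoods in the locality axiom pull back to [M]. *)
have CDF : smooth_map C D F by [].
apply: (gb D); split=> //.
split=> [f floc|n w a wC aC]; last exact: (proj2 Cdiff n w _ wC aC).
apply: (proj1 Cdiff) => m; have [V [FmV [a aC fa]]] := floc (F m).
exists (F @^-1` V); split; last by exists (a \o F) => // x /fa.
exact: diff_topology_continuous CDF _ _ FmV.
Qed.

Lemma image_closure_subset {T U : topologicalType} {f : T -> U} {A : set T}
    {B : set U} :
  continuous f -> A `<=` f @^-1` B -> closure A `<=` f @^-1` closure B.
Proof.
by move=> fc AB x Ax V /fc /Ax[y [/AB By Vfy]]; exists (f y).
Qed.

Section restriction.
Context {R : realType} {M : choiceType} {G H : set (M -> R)}.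
Variable GH : G `<=` H.

(** Coordinates are indexed by subset types, so the inclusion of families becomes a map of indices,
    and forgetting coordinates is precomposition with it. *)
Definition generator_incl (g : G) : H :=
  exist _ (set_val g) (mem_set (GH _ (set_valP g))).

Definition compt_restr_fun (x : {ptws H -> R}) : {ptws G -> R} :=
  x \o generator_incl.

Lemma compt_restr_fun_continuous : continuous compt_restr_fun.
Proof.
apply: (@continuous_sup_initial G _ (fun=> R) (fun g => @^~ g)) => g.
exact: (@sup_initial_proj_continuous H _ (fun=> R) (fun h => @^~ h)).
Qed.

Lemma compt_restr_subproof (x : compt H) :
  compt_restr_fun (set_val x) \in @compt_set R M G.
Proof.
apply/mem_set.
apply: (image_closure_subset compt_restr_fun_continuous _ _ (set_valP x)).
by move=> _ [m _ <-]; exists m.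
Qed.

Definition compt_restr (x : compt H) : compt G :=
  exist _ (compt_restr_fun (set_val x)) (compt_restr_subproof x).

Lemma compt_restr_smooth :
  smooth_map (compt_structure H) (compt_structure G) compt_restr.
Proof.
apply: smooth_map_gen; first exact: gen_differential_structure.
move=> _ [g _ <-]; apply: sub_gen_smallest.
(* By conversion, coordinate [g] after restriction is coordinate [generator_incl g] before it. *)
by exists (generator_incl g).
Qed.

Lemma compt_restr_to_compt : compt_restr \o to_compt H = to_compt G.
Proof. by apply/funext => m; exact/val_inj. Qed.

End restriction.

Theorem mainTheorem6 (R : realType) (M : choiceType) (C G H : set (M -> R))
    (M_neq0 : [set: M] !=set0)
    (C_diff : differential_structure C)
    (C_hausdorff : hausdorff_space (diff_topology C))
    (G_gen : gen G = C) (G_bounded : forall g, G g -> bounded_fun g)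
    (H_gen : gen H = C) (H_bounded : forall h, H h -> bounded_fun h)
    (GH : G `<=` H) :
  exists iota : compt H -> compt G,
    smooth_map (compt_structure H) (compt_structure G) iota /\
    iota \o to_compt H = to_compt G.
Proof.
exists (compt_restr GH); split.
  exact: compt_restr_smooth.
exact: compt_restr_to_compt.
Qed.
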